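(* Let $q$ be a prime power and let $s$ and $k$ be positive integers such that $\gcd(k,q-1)=1$ and $k\geq 2$. If there exists an $(m,k,d_2)^2_q$ linear code $\mathcal{D}$, then there exists an $$\left(s\,\frac{q^k-1}{q-1}+m,\;k,\;s\,\frac{q^k-q^{k-2}}{q-1}+d_2\right)^2_q$$ linear code $\overline{\mathcal{C}}$. Furthermore, if $\mathcal{D}$ is optimal with respect to the $2$-symbol Griesmer bound, then $\overline{\mathcal{C}}$ is also optimal with respect to that bound; and if $\mathcal{D}$ is distance-optimal with respect to the $2$-symbol Griesmer bound, then $\overline{\mathcal{C}}$ is also distance-optimal with respect to that bound.
   Context: For $\mathbf{a},\mathbf{c}\in\mathbb{F}_q^n$, the $b$-symbol distance is $d_b(\mathbf{a},\mathbf{c})=|\{0\le i\le n-1:(a_i,\ldots,a_{i+b-1})\neq(c_i,\ldots,c_{i+b-1})\}|$, with subscripts taken modulo $n$. An $(n,k,d_b)^b_q$ linear code is a $k$-dimensional $\mathbb{F}_q$-subspace of $\mathbb{F}_q^n$ whose minimum $b$-symbol distance between distinct codewords equals $d_b$. Here $b=2$. The $b$-symbol Griesmer bound for an $(n,k,d_b)^b_q$ linear code is $$\frac{(q^b-1)n}{q-1}\ge\sum_{i=0}^{k-1}\left\lceil\frac{q^{b-1}d_b}{q^i}\right\rceil .$$ For $b=2$ it reads $(q+1)n\ge\sum_{i=0}^{k-1}\left\lceil q\,d_2/q^i\right\rceil$. An $(n,k,d_b)^b_q$ linear code is optimal with respect to this bound if equality holds. It is distance-optimal with respect to this bound if the bound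 rules out an $(n,k,d_b+1)^b_q$ linear code, i.e. if the inequality fails when $d_b$ is replaced by $d_b+1$. *)

(* Defs.v *)
From HB Require Import structures.
From mathcomp Require Import all_boot all_order all_algebra.

Set Implicit Arguments.
Unset Strict Implicit.
Unset Printing Implicit Defensive.

Import Order.TTheory GRing.Theory Num.Theory.

Local Open Scope ring_scope.

(* (a_i, ..., a_{i+b-1}); [ordS] is the successor on 'I_n modulo n, so the
   subscripts are read modulo n. *)
Definition bsymbol (F : finFieldType) (b n : nat) (a : 'rV[F]_n) (i : 'I_n) :
    'rV[F]_b :=
  \row_(j < b) a 0 (iter j (@ordS n) i).

Definition bdist (F : finFieldType) (b n : nat) (a c : 'rV[F]_n) : nat :=
  #|[set i : 'I_n | bsymbol b a i != bsymbol b c i]|.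

Definition min_bdist (F : finFieldType) (b n : nat) (C : {vspace 'rV[F]_n})
    (d : nat) : Prop :=
  (exists a c, [/\ a \in C, c \in C, a != c & bdist b a c = d]) /\
  (forall a c, a \in C -> c \in C -> a != c -> (d <= bdist b a c)%N).

(* C is an (n, k, d)^b_q linear code, with q = #|F|. *)
Definition bsymbol_code (F : finFieldType) (b n k d : nat)
    (C : {vspace 'rV[F]_n}) : Prop :=
  \dim C = k /\ min_bdist b C d.

(* The two sides of the b-symbol Griesmer bound, as rational numbers. *)
Definition griesmer_lhs (q b n : nat) : rat :=
  (q%:R ^+ b - 1) * n%:R / (q%:R - 1).

Definition griesmer_rhs (q b k d : nat) : rat :=
  (\sum_(i < k) Num.ceil ((q%:R ^+ b.-1 * d%:R) / q%:R ^+ i : rat))%:~R.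

Definition griesmer_bound (q b n k d : nat) : Prop :=
  griesmer_rhs q b k d <= griesmer_lhs q b n.

Definition griesmer_optimal (F : finFieldType) (b n k d : nat)
    (C : {vspace 'rV[F]_n}) : Prop :=
  bsymbol_code b k d C /\ griesmer_lhs #|F| b n = griesmer_rhs #|F| b k d.

Definition griesmer_distance_optimal (F : finFieldType) (b n k d : nat)
    (C : {vspace 'rV[F]_n}) : Prop :=
  bsymbol_code b k d C /\ ~ griesmer_bound #|F| b n k d.+1.

(* Main.v *)
From HB Require Import structures.
Require Import Defs.
From mathcomp Require Import all_boot all_order all_algebra.
From mathcomp Require Import all_fingroup all_solvable all_field.
From mathcomp Require Import zify ring.

(* Idea: as gcd(k, q - 1) = 1, some b in F_{q^k} of order
   n = (q^k - 1)/(q - 1) has powers representing each point of the projective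
   space once.  For every nonzero functional g, the word (g(b^i))_i is cyclic
   of length n, and (g(b^i), g(b^(i+1))) vanishes exactly when b^i lies in a
   fixed subspace of dimension k - 2, so its 2-symbol weight is
   (q^k - q^(k-2))/(q - 1).  Parametrise D linearly by psi : F_{q^k} -> D,
   choose a coordinate j not vanishing identically on D, and insert s periods
   of the word psi(x b^i)_j just before position j of psi(x).  The inserted
   block starts with psi(x)_j and is followed by psi(x)_j, so all pairs of
   consecutive symbols of both words survive and the weights add up.  Both
   sides of the Griesmer bound increase by s(q + 1)n. *)

Set Implicit Arguments.
Unset Strict Implicit.
Unset Printing Implicit Defensive.

Import Order.TTheory GRing.Theory Num.Theory.

(** * Geometric sums and coprimality *)

Lemma subn1_divn_expn q k : (1 < q)%N ->
  ((q ^ k - 1) %/ (q - 1) = \sum_(i < k) q ^ i)%N.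
Proof. by move=> q_gt1; rewrite !subn1 predn_exp mulKn // -subn1 subn_gt0. Qed.

(** Each q^i is 1 modulo q - 1, so the sum is k modulo q - 1. This turns the gcd hypothesis on k
    into one on the length of the simplex word. *)
Lemma coprime_geom_sum q k : (0 < q)%N ->
  coprime (\sum_(i < k) q ^ i) (q - 1) = coprime k (q - 1).
Proof.
move=> q_gt0; rewrite -coprime_modl -[in RHS]coprime_modl; congr coprime.
have q1 : q = 1 %[mod q - 1] by have := modnDl 1 (q - 1); rewrite subnK.
have qm i : q ^ i = 1 %[mod q - 1] by rewrite -modnXm q1 modnXm exp1n.
elim: k => [|k IH]; first by rewrite big_ord0.
by rewrite big_ord_recr -modnDm IH qm modnDm addn1.
Qed.

Local Open Scope ring_scope.

(** * Extensions of finite fields and primitive roots *)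

Lemma finField_ext_of_degree (F : finFieldType) k :
  (0 < k)%N -> exists L : splittingFieldType F, \dim {:L} = k.
Proof.
move=> k_gt0; pose q := #|F|; pose N := (q ^ k)%N.
have q_gt1 : (1 < q)%N := finNzRing_gt1 F.
have N_gt1 : (1 < N)%N by rewrite (ltn_exp2l 0).
(* The splitting field of this polynomial turns out to consist of exactly its N distinct roots;
   cardinality q^k then forces degree k. *)
pose P (R : comNzRingType) : {poly R} := 'X^N - 'X.
have szP (R : comNzRingType) : size (P R) = N.+1.
  by rewrite size_polyDl size_polyXn // size_polyN size_polyX.
have /FinSplittingFieldFor[L [zs]] : P F != 0 by rewrite -size_poly_gt0 szP.
rewrite rmorphB /= map_polyXn map_polyX -/(P L) => zsP zsL.
exists L; have [a _ aE] := finField_galois_generator (sub1v {:L}).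
rewrite /= dimv1 expn1 -/q in aE.
pose E := fixedSpace (a ^+ k)%g.
have akE x : (a ^+ k)%g x = x ^+ N.
  rewrite /N; elim: (k) => [|i IH]; first by rewrite gal_id.
  by rewrite expgSr galM ?memvf // IH aE ?memvf // expnSr exprM.
(* The roots of X^N - X are the fixed points of the k-th power of the
   Frobenius automorphism, so they form a subfield. *)
have zsE : zs =i E.
  move=> z; rewrite -root_prod_XsubC -(eqp_root zsP) (sameP fixedSpaceP eqP).
  by rewrite akE rootE !hornerE subr_eq0.
have EL : E = {:L}%VS.
  apply/eqP; rewrite eqEsubv subvf -zsL -[E]subfield_closed agenvS //.
  by rewrite subv_add sub1v; apply/span_subvP=> z; rewrite zsE.
(* N is a positive power of the characteristic, so the derivative of X^N - X is -1 and the roots are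
   distinct. *)
have Nq0 : N%:R = 0 :> L.
  have [p p_pr pF] := finPcharP F.
  have pL : p \in [pchar L] by rewrite pchar_lalg.
  have qE : q = (p ^ logn p q)%N := card_pprimeChar pF.
  have e_gt0 : (0 < logn p q)%N.
    by rewrite lt0n; apply: contraTneq q_gt1 => e0; rewrite qE e0.
  apply/eqP; rewrite -(dvdn_pcharf pL) /N qE -expnM dvdn_exp // muln_gt0.
  by rewrite e_gt0.
have zsU : uniq zs.
  rewrite -separable_prod_XsubC -(eqp_separable zsP) separable_poly.unlock.
  rewrite /P derivB derivXn derivX -[_ *+ _]mulr_natl.
  rewrite -polyC_natr Nq0 polyC0 mul0r sub0r.
  by rewrite -[- 1]scaleN1r coprimepZr ?oppr_eq0 ?oner_neq0 // coprimep1.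
pose Fm := FinFieldExtType L; have oFm : #|Fm| = N.
  have /eq_card-> : Fm =i zs by move=> z; rewrite zsE EL memvf.
  apply: succn_inj; rewrite (card_uniqP _) //= -(size_prod_XsubC _ id).
  by rewrite -(eqp_size zsP) szP.
apply: (expnI q_gt1); rewrite -/N -oFm.
have := card_vspace (T := Fm) {:L}%VS.
by rewrite card_vspacef => <-.
Qed.

(** All nonzero elements are roots of unity of order dividing |F| - 1, and there are enough of them
    for [has_prim_root]. *)
Lemma finField_prim_root (F : finFieldType) :
  exists x : F, #|F|.-1.-primitive_root x.
Proof.
have := finNzRing_gt1 F; have := @expf_card F; have := cardC1 (0 : F).
case: #|F| => [|[|N]] //= oF1 FE _.
have /hasP[x _ xP] : has N.+1.-primitive_root (enum (predC1 (0 : F))).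
  apply: has_prim_root; rewrite ?enum_uniq // -?cardE ?oF1 //.
  apply/allP=> x; rewrite mem_enum inE => x0.
  rewrite unity_rootE; apply/eqP/(mulfI x0).
  by rewrite -exprS FE mulr1.
by exists x.
Qed.

Lemma dim_cap_lker_functional (K : fieldType) (V : vectType K)
    (U : {vspace V}) (g : 'Hom(V, K^o)) :
  ~~ (U <= lker g)%VS -> \dim (U :&: lker g) = (\dim U).-1.
Proof.
move=> Ug; rewrite -(limg_ker_dim g U).
suffices -> : \dim (g @: U) = 1%N by rewrite addn1.
apply/eqP; rewrite eqn_leq lt0n dimv_eq0; apply/andP; split.
  by apply: leq_trans (dimvS (subvf _)) _; rewrite dimvf.
by apply: contra Ug => /eqP gU; rewrite lkerE gU.
Qed.

(** * The 2-symbol weight of a simplex word *)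

Section SimplexCode.

Variables (F : finFieldType) (L : fieldExtType F) (n : nat) (b : L).
Let q := #|F|.
Hypothesis dimL_gt1 : (1 < \dim {:L})%N.
Hypothesis oL : (q ^ \dim {:L} = (q - 1) * n + 1)%N.
Hypothesis co_n : coprime n (q - 1)%N.
Hypothesis b_prim : n.-primitive_root b.

Let q_gt1 : (1 < q)%N := finNzRing_gt1 F.
Let n_gt0 : (0 < n)%N := prim_order_gt0 b_prim.
Let b_neq0 : b != 0. Proof. by rewrite (prim_root_eq0 b_prim) -lt0n. Qed.

Let expf_q1 (c : F) : c != 0 -> c ^+ (q - 1)%N = 1.
Proof.
move=> c0; apply: (mulfI c0).
by rewrite -exprS subn1 prednK ?expf_card ?mulr1 // ltnW.
Qed.

(** A scalar [b] would have order n dividing q - 1; coprimality gives n = 1, and [oL] then makes L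
    one-dimensional. *)
Let b_notin_F (c : F) : b != c%:A.
Proof.
apply/eqP=> bc; have c0 : c != 0.
  by apply: contraNneq b_neq0 => c0; rewrite bc c0 scale0r.
have : (n %| (q - 1))%N.
  by rewrite (prim_order_dvd b_prim) bc -in_algE -rmorphXn expf_q1 ?rmorph1.
move/gcdn_idPl; rewrite (eqP co_n) => n1.
move: oL; rewrite -n1 muln1 subnK 1?ltnW //.
by rewrite -[RHS]expn1 => /(expnI q_gt1) e; move: dimL_gt1; rewrite e.
Qed.

(* Raising to the power q - 1 kills the scalar and, as n is coprime to q - 1,
   still separates the powers of b. *)
Let scale_b_inj : {in setX [set~ (0 : F)] [set: 'I_n] &,
  injective (fun p : F * 'I_n => p.1 *: b ^+ p.2)}.
Proof.
move=> [c i] [d j] /setXP[/= + _] /setXP[/= + _]; rewrite !inE => c0 d0 e.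
have bq_prim : n.-primitive_root (b ^+ (q - 1)%N).
  by rewrite (prim_root_exp_coprime _ b_prim) coprime_sym.
have /eqP : (b ^+ (q - 1)%N) ^+ i = (b ^+ (q - 1)%N) ^+ j.
  have := congr1 (fun x => x ^+ (q - 1)%N) e.
  by rewrite !exprZn !expf_q1 // !scale1r -!exprM mulnC [in RHS]mulnC.
rewrite (eq_prim_root_expr bq_prim) !modn_small // => /eqP/val_inj ij.
move/eqP: e; rewrite ij -subr_eq0 -scalerBl scaler_eq0 subr_eq0.
by rewrite (negPf (expf_neq0 _ b_neq0)) orbF => /eqP->.
Qed.

(** The dimension drops once for g and once more for y -> g (y b), which does not vanish on the
    kernel of g. *)
Let dim_two_kernels (g : 'Hom(L, F^o)) y0 : g y0 != 0 ->
  \dim (lker g :&: lker (g \o amulr b)) = (\dim {:L} - 2)%N.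
Proof.
move=> gy0; rewrite dim_cap_lker_functional.
  rewrite -[lker g]capfv dim_cap_lker_functional; first by rewrite subn2.
  by apply: contra gy0 => /subvP/(_ y0 (memvf _)); rewrite memv_ker.
(* Otherwise g (y b) = c g y for all y, hence g vanishes on L (b - c) = L. *)
apply/subvP=> sub_ker; pose c := g (y0 * b) / g y0.
have gb0 y : g (y * (b - c%:A)) = 0.
  have : y - (g y / g y0) *: y0 \in lker g.
    by rewrite memv_ker linearB linearZ /= [_ *: _]divfK ?subrr.
  move/sub_ker; rewrite memv_ker comp_lfunE lfunE /= mulrBl mulrBr !linearB /=.
  rewrite -scalerAl -scalerAr mulr1 !linearZ /=.
  rewrite !scalerN => /eqP/subr0_eq->; apply/eqP; rewrite subr_eq0; apply/eqP.
  change (g y / g y0 * g (y0 * b) = g (y0 * b) / g y0 * g y :> F).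
  by rewrite mulrC mulrA mulrAC.
have bc0 : b - c%:A != 0 by rewrite subr_eq0 b_notin_F.
by move: gy0; rewrite -[y0](divfK bc0) gb0 eqxx.
Qed.

(** The map (c, i) -> c b^i is a bijection from nonzero scalars times indices onto the nonzero
    elements of L. It carries the indices in [S] to the complement of the common kernel [W], whose
    size is known. *)
Lemma card_simplex_support2 (g : 'Hom(L, F^o)) y0 : g y0 != 0 ->
  (#|[set i : 'I_n | (g (b ^+ i) != 0) || (g (b ^+ i.+1) != 0)]%R| * (q - 1) =
   q ^ \dim {:L} - q ^ (\dim {:L} - 2))%N.
Proof.
move=> gy0; set S := [set i | _].
pose T : finType := finvect_type L.
pose h (p : F * 'I_n) : T := p.1 *: b ^+ p.2.
have cardT : #|T| = (q ^ \dim {:L})%N.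
  by have := card_vspace (T := T) {:L}%VS; rewrite card_vspacef.
have card_scal : #|[set~ (0 : F)]| = (q - 1)%N by rewrite cardsC1 subn1.
have h_onto : h @: setX [set~ 0] [set: 'I_n] = [set~ 0].
  apply/eqP; rewrite eqEcard; apply/andP; split.
    apply/subsetP=> _ /imsetP[[c i] /setXP[/= + _] ->]; rewrite !inE => c0.
    by rewrite scaler_eq0 negb_or c0 expf_neq0.
  rewrite card_in_imset // cardsX card_scal cardsT card_ord cardsC1 cardT.
  by rewrite oL addn1.
pose W : {vspace L} := (lker g :&: lker (g \o amulr b))%VS.
have h_supp : h @: setX [set~ 0] S = ~: [set y : T | y \in W].
  apply/setP=> y; apply/imsetP/idP.
    case=> [[c i] /setXP[/=]]; rewrite !inE => c0 iS ->.
    rewrite memv_cap !memv_ker comp_lfunE lfunE /= -scalerAl -exprSr.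
    rewrite !linearZ /=.
    by rewrite negb_and !mulf_eq0 !negb_or c0.
  rewrite !inE => yW; have : y \in [set~ 0].
    by rewrite !inE; apply: contraNneq yW => ->; rewrite mem0v.
  rewrite -h_onto => /imsetP[[c i] /setXP[/= c0 _] yE]; exists (c, i) => //.
  apply/setXP; split=> //; move: yW.
  rewrite !inE yE memv_cap !memv_ker comp_lfunE lfunE /=.
  rewrite -scalerAl -exprSr !linearZ /= negb_and.
  apply: contraLR; rewrite !negb_or !negbK => /andP[/eqP-> /eqP->].
  by rewrite !scaler0 eqxx.
rewrite mulnC -card_scal -cardsX.
have <- : #|h @: setX [set~ 0] S| = #|setX [set~ (0 : F)] S|.
  apply: card_in_imset => -[c i] [d j] /setXP[c0 _] /setXP[d0 _].
  by apply: scale_b_inj; apply/setXP; split; rewrite ?in_setT.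
rewrite h_supp cardsCs setCK cardsE.
by rewrite cardT card_vspace (dim_two_kernels gy0).
Qed.

End SimplexCode.

(** * Pair weights of words and their behaviour under insertion *)

Definition pair_nz (F : nzRingType) (u : nat -> F) (i : nat) : nat :=
  (u i != 0) || (u i.+1 != 0).

Definition splice (T : Type) (j t : nat) (w v : nat -> T) (i : nat) : T :=
  if (i < j)%N then v i else if (i < j + t)%N then w (i - j)%N else v (i - t)%N.

Lemma bdist_eq0 (F : finFieldType) b n (a c : 'rV[F]_n) :
  (bdist b.+1 a c == 0%N) = (a == c).
Proof.
apply/idP/eqP=> [|->]; last first.
  by rewrite cards_eq0; apply/eqP/setP=> i; rewrite !inE eqxx.
rewrite cards_eq0 => /eqP/setP e; apply/rowP=> i.
by have := e i; rewrite !inE => /negbFE/eqP/rowP/(_ 0); rewrite !mxE.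
Qed.

(** Encoding the difference word as a function on [nat] reduces the cyclic wraparound to the
    condition [u n = u 0], so index ranges can be split and shifted freely. *)
Lemma bdist2E (F : finFieldType) n (a c : 'rV[F]_n) (u : nat -> F) :
  (forall i : 'I_n, u i = a 0 i - c 0 i) -> u n = u 0%N ->
  bdist 2 a c = (\sum_(i < n) pair_nz u i)%N.
Proof.
move=> uE un; rewrite /bdist -sum1_card big_mkcond; apply: eq_bigr => i _.
have uS : u i.+1 = a 0 (ordS i) - c 0 (ordS i).
  rewrite -uE /=; have [lt_i|] := ltnP i.+1 n; first by rewrite modn_small.
  move=> le_n; have -> : i.+1 = n by apply/eqP; rewrite eqn_leq ltn_ord.
  by rewrite modnn un.
rewrite inE /pair_nz uE uS !subr_eq0 -negb_and.
suffices -> : (bsymbol 2 a i == bsymbol 2 c i) =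
  (a 0 i == c 0 i) && (a 0 (ordS i) == c 0 (ordS i)) by case: (_ && _).
apply/eqP/andP=> [/rowP e|[/eqP e0 /eqP e1]].
  by have := e 0; have := e 1; rewrite !mxE /= => -> ->.
by apply/rowP=> -[[|[|//]] ?]; rewrite !mxE.
Qed.

(** Only the two junctions matter: [w 0 = v j] keeps the pair of [v] entering position j, and
    [w t = v j] keeps the last pair of the block. Hence [spliceL] and [spliceM] hold up to and
    including their right endpoints. *)
Lemma sum_pair_nz_splice (F : nzRingType) (v w : nat -> F) j t m :
    (j <= m)%N -> w 0%N = v j -> w t = v j ->
  (\sum_(i < t + m) pair_nz (splice j t w v) i =
   \sum_(i < t) pair_nz w i + \sum_(i < m) pair_nz v i)%N.
Proof.
move=> le_jm w0 wt.
have spliceL i : (i <= j)%N -> splice j t w v i = v i.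
  rewrite /splice leq_eqVlt => /predU1P[->|->] //.
  rewrite ltnn -{1}[j]addn0 ltn_add2l.
  by case: t wt => [|t'] _; rewrite /= ?subn0 // subnn.
have spliceM i : (i <= t)%N -> splice j t w v (j + i) = w i.
  rewrite /splice ltnNge leq_addr ltn_add2l addKn /= leq_eqVlt.
  case/predU1P=> [->|-> //].
  by rewrite ltnn addnK.
have spliceR i : splice j t w v (t + (j + i)) = v (j + i)%N.
  by rewrite /splice !ltnNge addnCA leq_addr leq_add2l leq_addr /= addnCA addKn.
rewrite -(subnKC le_jm) addnCA !big_split_ord /= addnCA.
congr (_ + (_ + _))%N; apply: eq_bigr => i _; rewrite /pair_nz;
  do ?rewrite -addnS.
- by rewrite !spliceM // ltnW.
- by rewrite !spliceL // ltnW.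
- by rewrite ![(j + (t + _))%N]addnCA !spliceR.
Qed.

Lemma sum_pair_nz_periodic (F : nzRingType) (w : nat -> F) n s :
    (forall i, w (n + i)%N = w i) ->
  (\sum_(i < s * n) pair_nz w i = s * \sum_(i < n) pair_nz w i)%N.
Proof.
move=> wn; elim: s => [|s IH]; first by rewrite !mul0n big_ord0.
rewrite !mulSn big_split_ord /= -IH; congr addn; apply: eq_bigr => i _.
by rewrite /pair_nz -addnS !wn.
Qed.

(** * Both sides of the 2-symbol Griesmer bound *)

Lemma griesmer_lhs2D q n n' : (1 < q)%N ->
  griesmer_lhs q 2 (n + n') = ((q + 1) * n)%:R + griesmer_lhs q 2 n'.
Proof.
move=> q_gt1; have q1 : (q%:R - 1 : rat) != 0.
  by rewrite subr_eq0 (eqr_nat _ q 1) gtn_eqF.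
by rewrite /griesmer_lhs natrM !natrD; field.
Qed.

(** The added distance is s (q + 1) q^(k-2), so it adds s (q + 1) q^(k-1-i) to the i-th summand.
    This is an integer for i < k and leaves the ceiling; the rest is a geometric sum. *)
Lemma griesmer_rhs2D q k s d : (1 < q)%N -> (1 < k)%N ->
  griesmer_rhs q 2 k (s * ((q ^ k - q ^ (k - 2)) %/ (q - 1)) + d) =
  ((q + 1) * (s * ((q ^ k - 1) %/ (q - 1))))%:R + griesmer_rhs q 2 k d.
Proof.
move=> q_gt1 k_gt1; have q_gt0 := ltnW q_gt1.
have q0 : (q%:R : rat) != 0 by rewrite pnatr_eq0 -lt0n.
have -> : ((q ^ k - q ^ (k - 2)) %/ (q - 1) = (q + 1) * q ^ (k - 2))%N.
  have -> : (q ^ k = q ^ (k - 2) * q ^ 2)%N by rewrite -expnD subnK.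
  set x := (q ^ (k - 2))%N.
  have -> : (x * q ^ 2 - x = (q + 1) * x * (q - 1))%N by nia.
  by rewrite mulnK ?subn_gt0.
rewrite subn1_divn_expn // /griesmer_rhs.
have summand (i : 'I_k) :
    Num.ceil (q%:R ^+ 1 * (s * ((q + 1) * q ^ (k - 2)) + d)%:R
              / q%:R ^+ i : rat) =
    ((q + 1) * s * q ^ (k.-1 - i))%:Z
      + Num.ceil (q%:R ^+ 1 * d%:R / q%:R ^+ i : rat).
  rewrite -[X in X + _](@intrKceil rat) -ceilDzr ?intr_int //; congr Num.ceil.
  have qE : (q ^ (k.-1 - i) * q ^ i = q * q ^ (k - 2))%N.
    by rewrite -expnD subnK -?expnS; [congr expn; lia | have := ltn_ord i; lia].
  have {}qE : (q%:R ^+ (k.-1 - i) = q%:R * q%:R ^+ (k - 2) / q%:R ^+ i :> rat).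
    by rewrite -!natrX -natrM -qE natrM mulfK // pnatr_eq0 -lt0n expn_gt0 q_gt0.
  rewrite -pmulrn !natrM natrX qE !natrD !natrM natrX.
  by field; rewrite expf_neq0.
rewrite (eq_bigr _ (fun i _ => summand i)) big_split intrD; congr (_ + _).
rewrite -(big_morph Posz PoszD (erefl _)) -big_distrr /= -pmulrn; congr _%:R.
rewrite mulnA (reindex_inj rev_ord_inj); congr muln; apply: eq_bigr => i _ /=.
by congr expn; have := ltn_ord i; lia.
Qed.

(** * Construction of the lengthened code *)

Lemma exists_lfun_onto_vspace (K : fieldType) (U V : vectType K)
    (D : {vspace V}) :
  \dim {:U} = \dim D -> exists f : 'Hom(U, V), lker f == 0%VS /\ limg f = D.
Proof.
move=> dUD; have [f fE] := linear_of_free (vbasis {:U}) (vbasis D).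
have {}fE := fE (basis_free (vbasisP _)).
rewrite !size_tuple in fE; have {}fE := fE (esym dUD).
have fD : limg (linfun f) = D.
  rewrite -(span_basis (vbasisP {:U})) limg_span.
  rewrite (eq_map (lfunE f)) fE; exact: span_basis (vbasisP D).
exists (linfun f); split=> //; rewrite -dimv_eq0 -(eqn_add2r (\dim D)) -{1}fD.
by rewrite -[lker _]capfv limg_ker_dim dUD.
Qed.

(** By [dist], all distances between distinct codewords grow by the same constant, so both the pair
    attaining the minimum and the lower bound carry over from [D]. *)
Lemma bsymbol_code_insert_simplex (F : finFieldType) (L : fieldExtType F)
    (n m s d2 : nat) (b : L) (D : {vspace 'rV[F]_m}) :
  let q := #|F| in let k := \dim {:L} in
  (1 < k)%N -> (q ^ k = (q - 1) * n + 1)%N -> coprime n (q - 1)%N ->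
  n.-primitive_root b -> bsymbol_code 2 k d2 D ->
  exists C : {vspace 'rV[F]_(s * n + m)},
    bsymbol_code 2 k (s * ((q ^ k - q ^ (k - 2)) %/ (q - 1)) + d2) C.
Proof.
move=> q k k_gt1 oL co_n b_prim [dimD [[a0 [c0 [a0D c0D ac0 dE]]] d_min]].
have [psi [psi_inj psiD]] := exists_lfun_onto_vspace (esym dimD).
have [j aj] : exists j, a0 0 j != c0 0 j.
  apply/existsP; apply: contraNT ac0 => /existsPn e.
  by apply/eqP/rowP=> j; apply/eqP/negPn.
(* Since a coordinate exists, the length is a successor, and [inZp] can continue the words of [D]
   cyclically. *)
case: m => [|m] in D a0 c0 psi j a0D c0D ac0 dE d_min dimD psi_inj psiD aj *.
  by case: j aj.
pose T := (s * n)%N.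
pose v x i : F := psi x 0 (inZp i).
pose w x i : F := psi (x * b ^+ i) 0 j.
pose u x := splice j T (w x) (v x).
have bn : b ^+ n = 1 := prim_expr_order b_prim.
have uP a x y i : u (a *: x + y) i = a * u x i + u y i.
  rewrite /u /splice /v /w.
  by do 2?case: ifP => _; rewrite ?mulrDl -?scalerAl linearP !mxE.
pose theta x : 'rV[F]_(s * n + m.+1) := \row_i u x i.
have theta_lin : linear theta by move=> a x y; apply/rowP=> i; rewrite !mxE uP.
pose th : {linear L -> 'rV[F]_(s * n + m.+1)} :=
  HB.pack theta (GRing.isLinear.Build F L _ *:%R theta theta_lin).
pose Th := linfun th.
have simplex_wt z : z != 0 ->
    (\sum_(i < n) pair_nz (w z) i = (q ^ k - q ^ (k - 2)) %/ (q - 1))%N.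
  move=> z0; pose g0 y : F^o := psi (z * y) 0 j.
  have g0_lin : linear g0.
    by move=> a x y; rewrite /g0 mulrDr -scalerAr linearP !mxE.
  pose g : {linear L -> F^o} :=
    HB.pack g0 (GRing.isLinear.Build F L F^o *:%R g0 g0_lin).
  (* The functional [g] is nonzero: at x0 / z it takes the value of a0 - c0 at coordinate j. *)
  have /memv_imgP[x0 _ x0E] : a0 - c0 \in limg psi by rewrite psiD rpredB.
  have gx0 : linfun g (x0 / z) != 0.
    by rewrite lfunE /= /g0 mulrC divfK // -x0E !mxE subr_eq0.
  rewrite -(card_simplex_support2 k_gt1 oL co_n b_prim gx0) mulnK; last first.
    by rewrite subn_gt0 finNzRing_gt1.
  rewrite -sum1_card [in RHS]big_mkcond; apply: eq_bigr => i _.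
  by rewrite inE !lfunE /= /pair_nz /w /g0; case: (_ || _).
have dist x y : x != y -> bdist 2 (Th x) (Th y) =
    (s * ((q ^ k - q ^ (k - 2)) %/ (q - 1)) + bdist 2 (psi x) (psi y))%N.
  move=> xy; have z0 : x - y != 0 by rewrite subr_eq0.
  have uB i : u (x - y) i = u x i - u y i.
    by rewrite -scaleN1r addrC uP mulN1r addrC.
  have wj0 : w (x - y) 0%N = v (x - y) j by rewrite /w /v mulr1 valZpK.
  have wjT : w (x - y) T = v (x - y) j.
    by rewrite -wj0 /w /T mulnC exprM bn expr1n mulr1.
  rewrite (@bdist2E _ _ _ _ (u (x - y))); last 2 first.
  - by move=> i; rewrite !lfunE /= !mxE uB.
  - rewrite /u /splice ltnNge (leq_trans (ltnW (ltn_ord j)) (leq_addl _ _)) /=.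
    rewrite ltnNge addnC leq_add2l (ltnW (ltn_ord j)) /= addKn.
    have vm : v (x - y) m.+1 = v (x - y) 0%N.
      by rewrite /v; congr (psi _ _ _); apply/val_inj; rewrite /= modnn mod0n.
    (* If j = 0, the new word begins with the block (or with [v] when the block is empty), and its
       first symbol is still [v 0]. *)
    rewrite vm; case: ltnP => // /[!leqn0] /eqP j0.
    by rewrite j0 !sub0n; case: ifP => // _; rewrite wj0 j0.
  rewrite (@bdist2E _ _ (psi x) (psi y) (v (x - y))); last 2 first.
  - by move=> i; rewrite /v valZpK linearB !mxE.
  - by rewrite /v; congr (psi _ _ _); apply/val_inj; rewrite /= modnn mod0n.
  rewrite /u sum_pair_nz_splice ?(ltnW (ltn_ord j)) //.
  rewrite sum_pair_nz_periodic => [|i]; last by rewrite /w exprD bn mul1r.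
  by rewrite simplex_wt.
(* Equal images are at distance 0, and [dist] then forces distance 0 between the [psi] images as
   well. *)
have Th_inj : lker Th == 0%VS.
  apply/lker0P=> x y e; have [//|xy] := eqVneq x y.
  have /eqP := dist x y xy; rewrite e.
  rewrite [X in X == _](eqP (_ : _ == 0%N)) ?bdist_eq0 // eq_sym addn_eq0.
  by rewrite bdist_eq0 (inj_eq (lker0P psi_inj)) (negPf xy) andbF.
exists (limg Th); split; last split.
- by rewrite limg_dim_eq // (eqP Th_inj) capv0.
- have /memv_imgP[x _ xE] : a0 \in limg psi by rewrite psiD.
  have /memv_imgP[y _ yE] : c0 \in limg psi by rewrite psiD.
  have xy : x != y by apply: contraNneq ac0 => xy; rewrite xE yE xy.
  exists (Th x), (Th y); rewrite !memv_img ?memvf // (inj_eq (lker0P Th_inj)).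
  by rewrite dist // -xE -yE dE.
- move=> _ _ /memv_imgP[x _ ->] /memv_imgP[y _ ->].
  rewrite (inj_eq (lker0P Th_inj)) => xy; rewrite dist // leq_add2l d_min //.
  + by rewrite -psiD memv_img ?memvf.
  + by rewrite -psiD memv_img ?memvf.
  by rewrite (inj_eq (lker0P psi_inj)).
Qed.

(** * Choice of [b] and proof of the theorem *)

Lemma finField_ext_prim_root (F : finFieldType) k :
  let q := #|F| in let n := ((q ^ k - 1) %/ (q - 1))%N in
  (0 < k)%N ->
  exists (L : splittingFieldType F) (b : L),
    \dim {:L} = k /\ n.-primitive_root b.
Proof.
move=> q n k_gt0; have [L dimL] := finField_ext_of_degree F k_gt0.
pose Fm := FinFieldExtType L; have [x x_prim] := finField_prim_root Fm.
have oFm : #|Fm| = (q ^ k)%N.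
  by have := card_vspace (T := Fm) {:L}%VS; rewrite card_vspacef dimL.
have n_dvd : (n %| #|Fm|.-1)%N.
  have q1_dvd : (q - 1 %| q ^ k - 1)%N by rewrite !subn1 predn_exp dvdn_mulr.
  by rewrite oFm -subn1 -[X in (_ %| X)%N](divnK q1_dvd) dvdn_mulr.
(* As n divides q^k - 1, this power of a generator of the multiplicative group has order exactly
   n. *)
exists L, (x ^+ (#|Fm|.-1 %/ n)); split=> //.
exact: (dvdn_prim_root x_prim n_dvd).
Qed.

Local Close Scope ring_scope.

Theorem theorem5 (q : nat) (F : finFieldType) (hF : #|F| = q)
    (s k : nat) (hs : (0 < s)%N) (hgcd : gcdn k (q - 1) = 1%N) (hk : (2 <= k)%N)
    (m d2 : nat) (D : {vspace 'rV[F]_m}) (hD : bsymbol_code 2 k d2 D) :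
  exists C : {vspace 'rV[F]_(s * ((q ^ k - 1) %/ (q - 1)) + m)},
    [/\ bsymbol_code 2 k (s * ((q ^ k - q ^ (k - 2)) %/ (q - 1)) + d2) C,
        griesmer_optimal 2 k d2 D ->
          griesmer_optimal 2 k
            (s * ((q ^ k - q ^ (k - 2)) %/ (q - 1)) + d2) C
      & griesmer_distance_optimal 2 k d2 D ->
          griesmer_distance_optimal 2 k
            (s * ((q ^ k - q ^ (k - 2)) %/ (q - 1)) + d2) C].
Proof.
subst q; have q_gt1 := finNzRing_gt1 F; have q_gt0 := ltnW q_gt1.
have [L [b [dimL b_prim]]] := finField_ext_prim_root F (ltnW hk).
have oL : (#|F| ^ \dim {:L} =
    (#|F| - 1) * ((#|F| ^ k - 1) %/ (#|F| - 1)) + 1)%N.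
  rewrite subn1_divn_expn // dimL subn1 -predn_exp addn1 prednK //.
  by rewrite expn_gt0 q_gt0.
have co_n : coprime ((#|F| ^ k - 1) %/ (#|F| - 1)) (#|F| - 1)%N.
  by rewrite subn1_divn_expn // coprime_geom_sum //; apply/eqP.
have [||C] := @bsymbol_code_insert_simplex F L _ m s d2 b D _ oL co_n b_prim.
- by rewrite dimL.
- by rewrite dimL.
rewrite dimL => hC; exists C; split=> // [[_ opt]|[_ opt]]; split=> //.
  by rewrite griesmer_lhs2D // griesmer_rhs2D // opt.
(* The successor is moved onto [d2], so the common increment cancels and the bound at [d2.+1]
   remains. *)
move: opt; rewrite /griesmer_bound -addnS.
by rewrite griesmer_lhs2D // griesmer_rhs2D // lerD2l.
Qed.
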